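(* Let $P$ be a cyclic polygon with $n$ vertices (i.e. a convex polygon in $\mathbb{R}^2$ all of whose $n$ vertices lie on a common circle). Then $\operatorname{xc}(P)\leq 24\sqrt{n}$.
   Context: The extension complexity $\operatorname{xc}(P)$ of a polytope $P$ is the minimum number of facets of a polytope $P'$ (in any dimension) such that $P$ is the image of $P'$ under a linear projection. *)

(* Defs.v *)
From HB Require Import structures.
From mathcomp Require Import all_boot all_order all_algebra.
From mathcomp Require Import all_classical all_reals ereal convex.

Set Implicit Arguments.
Unset Strict Implicit.
Unset Printing Implicit Defensive.

Import Order.TTheory GRing.Theory Num.Theory.

Local Open Scope classical_set_scope.
Local Open Scope card_scope.
Local Open Scope ring_scope.

Section Polytopes.
Variable R : realType.

Definition conv_hull d (A : set 'rV[R]_d) : set 'rV[R]_d :=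
  smallest (@convex_set R 'rV[R]_d) A.

Definition polytope d (P : set 'rV[R]_d) : Prop :=
  exists2 A, finite_set A & P = conv_hull A.

(* The points, given by the rows of X, are affinely independent iff the vectors
   (x, 1) are linearly independent. *)
Definition affinely_independent k d (X : 'M[R]_(k, d)) : bool :=
  row_free (row_mx X (const_mx 1 : 'cV_k)).

(* The largest number of affinely independent points of S, minus one; thus
   affdim set0 = -1.  At most d + 1 points of R^d are affinely independent. *)
Definition affdim d (S : set 'rV[R]_d) : int :=
  (\max_(k < d.+2 | `[< exists X : 'M[R]_(k, d),
       affinely_independent X /\ forall i, S (row i X) >]) k)%:Z - 1.

(* P is a face of itself (take a = 0 and b = 0), and set0 is a face of P (take
   a = 0 and b = 1). *)
Definition face d (P F : set 'rV[R]_d) : Prop :=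
  exists (a : 'cV[R]_d) (b : R),
    (forall x, P x -> (x *m a) 0 0 <= b) /\
    F = [set x | P x /\ (x *m a) 0 0 = b].

Definition facet d (P F : set 'rV[R]_d) : Prop :=
  face P F /\ affdim F = affdim P - 1.

Definition vertex d (P : set 'rV[R]_d) (v : 'rV[R]_d) : Prop :=
  face P [set v].

Definition extension e (P : set 'rV[R]_e) d (Q : set 'rV[R]_d) : Prop :=
  polytope Q /\ exists f : {linear 'rV[R]_d -> 'rV[R]_e}, P = f @` Q.

(* The infimum of a set of natural numbers is its minimum, unless the set is
   empty, in which case it is +oo. *)
Definition xc e (P : set 'rV[R]_e) : \bar R :=
  ereal_inf [set (k%:R)%:E | k in [set k : nat |
    exists (d : nat) (Q : set 'rV[R]_d),
      extension P Q /\ facet Q #= `I_k]].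

(* Written with coordinates since the norm of 'rV[R]_2 is the maximum norm. *)
Definition circle (c : 'rV[R]_2) (r : R) : set 'rV[R]_2 :=
  [set x | (x 0 0 - c 0 0) ^+ 2 + (x 0 1 - c 0 1) ^+ 2 = r ^+ 2].

Definition polygon (P : set 'rV[R]_2) : Prop := polytope P /\ affdim P = 2.

Definition cyclic_polygon (P : set 'rV[R]_2) : Prop :=
  polygon P /\
  exists c r, 0 < r /\ vertex P `<=` circle c r.

End Polytopes.

(* Main.v *)
(* A stereographic projection from a point of the circle that is not a vertex
   turns the vertices into reals t_0 < ... < t_(n-1), and, up to positive factors
   depending on the vertex only, the slack of the vertex t at the edge [a, b]
   into (t - a)(t - b).  By Yannakakis' theorem it suffices to factor this matrix
   through O(sqrt n) nonnegative coordinates.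

   Cut the t_i into s ~ sqrt n consecutive blocks of s points.  Outside the
   columns of a block [l, r], the function (t - a)(t - b) with l <= a, b <= r lies
   in the cone generated by (t - l)^2, (t - l)(t - r) and (t - r)^2, which costs
   3 coordinates per block.  The s diagonal s x s subblocks must share their
   coordinates: the g-th point of every block uses one and the same coordinate.
   This perturbs the off-diagonal part, replacing the point x of block i by
   "x with weight q_i^2 minus y with weight q_j^2", y being the g-th point of
   block j, and the perturbed part stays in the cone as soon as
   q_j |y - e| <= q_i |x - e| at both ends e of block j.  Such weights exist
   when the distance of any two blocks is at least 5/2 times the length of the
   shorter one (add the blocks one at a time, the longest first), and a greedy
   colouring splits the blocks into 7 classes with this property.  The total is
   7 s + 3 s + 1 <= 24 sqrt n coordinates, the last one for the edge
   [t_0, t_(n-1)]. *)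

Require Import Defs.
From mathcomp Require Import all_boot all_order all_algebra.
From mathcomp Require Import all_classical all_reals ereal convex.
From mathcomp Require Import interval_inference ring lra zify.

Set Implicit Arguments.
Unset Strict Implicit.
Unset Printing Implicit Defensive.

Import Order.TTheory GRing.Theory Num.Theory.

Local Open Scope classical_set_scope.
Local Open Scope card_scope.
Local Open Scope ring_scope.

(** * Colouring and weighting intervals *)

Section Intervals.
Variables (R : realFieldType) (I : eqType) (l r : I -> R).
Hypothesis ltlr : forall i, l i < r i.
Implicit Types (s : seq I) (i j : I).

(** The factor 5/2 lies above [1 + sqrt 2], the bound behind [far_points_swap], and below 3, so that
    three conflict codes per side are enough. *)
Definition apart i j := forall x y, l i <= x <= r i -> l j <= y <= r j ->
  5 / 2 * Num.min (r i - l i) (r j - l j) <= `|x - y|.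

Definition disjoint_itvs s :=
  {in s &, forall i j, i != j -> r i <= l j \/ r j <= l i}.

Definition shorter i j := r i - l i <= r j - l j.

Lemma apart_sym i j : apart i j -> apart j i.
Proof. by move=> h x y xj yi; rewrite distrC minC; apply: h. Qed.

Lemma sorted_shorter s : exists s', sorted shorter s' /\ s =i s'.
Proof.
exists (sort shorter s); split; last by move=> i; rewrite mem_sort.
by apply: sort_sorted => i j; apply: le_total.
Qed.

Lemma shorter_head i s : sorted shorter (i :: s) ->
  {in s, forall j, shorter i j} /\ sorted shorter s.
Proof.
move=> ss; split; last exact: path_sorted ss.
have /allP : all (shorter i) s by apply: order_path_min ss => a b c; apply: le_trans.
by [].
Qed.

Lemma apart_shorter i j : shorter i j ->
  r i + 5 / 2 * (r i - l i) <= l j \/ r j + 5 / 2 * (r i - l i) <= l i ->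
  apart i j.
Proof.
move=> ij far x y xi yj; rewrite (min_l ij); have := ltlr i; have := ltlr j.
by case: far => far ? ?; rewrite ler_normr; apply/orP; [right|left]; lra.
Qed.

(* Which of the at most three intervals on either side of i, that are longer
   than i and too close to i, is j? *)
Definition conflict_code i j : bool * 'I_3 :=
  let d := if r i <= l j then l j - r i else l i - r j in
  (r i <= l j,
   if d < r i - l i then 0 else if d < 2 * (r i - l i) then 1 else 2).

(** Disjoint intervals on the same side of i, both at least as long as i, have gaps to i that differ
    by at least the length of i. Conflicting gaps with the same code differ by less. *)
Lemma conflict_code_inj i j k :
  shorter i j -> shorter i k ->
  r i <= l j \/ r j <= l i -> r i <= l k \/ r k <= l i ->
  r j <= l k \/ r k <= l j ->
  ~ apart i j -> ~ apart i k -> conflict_code i j <> conflict_code i k.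
Proof.
move=> ij ik dij dik djk nij nik.
have nij' : ~ (r i + 5 / 2 * (r i - l i) <= l j \/
               r j + 5 / 2 * (r i - l i) <= l i).
  by move=> h; apply: nij; apply: apart_shorter.
have nik' : ~ (r i + 5 / 2 * (r i - l i) <= l k \/
               r k + 5 / 2 * (r i - l i) <= l i).
  by move=> h; apply: nik; apply: apart_shorter.
have [nij1 nij2] : l j < r i + 5 / 2 * (r i - l i) /\
    l i < r j + 5 / 2 * (r i - l i).
  by split; rewrite ltNge; apply/negP => ?; apply: nij'; [left|right].
have [nik1 nik2] : l k < r i + 5 / 2 * (r i - l i) /\
    l i < r k + 5 / 2 * (r i - l i).
  by split; rewrite ltNge; apply/negP => ?; apply: nik'; [left|right].
have := ltlr i; have := ltlr j; have := ltlr k.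
rewrite /shorter in ij ik.
rewrite /conflict_code => hi hj hk [].
case: (leP (r i) (l j)) => cj; case: (leP (r i) (l k)) => ck //= _.
all: do 4 ?[case: ltP => ?] => //; case: djk => ? _; lra.
Qed.

(** The head of the sorted list is the shortest interval and is coloured last, so only longer ones
    block a colour. If all seven colours were blocked, choosing a blocker for each would inject
    ['I_7] into the six conflict codes. *)
Lemma coloring s : disjoint_itvs s -> exists c : I -> 'I_7,
  {in s &, forall i j, i != j -> c i = c j -> apart i j}.
Proof.
have [s' [ss' eqs]] := sorted_shorter s => dis.
have {}dis : disjoint_itvs s' by move=> i j; rewrite -!eqs; apply: dis.
suff [c hc] : exists c : I -> 'I_7,
    {in s' &, forall i j, i != j -> c i = c j -> apart i j}.
  by exists c => i j; rewrite !eqs; apply: hc.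
elim: s' ss' dis {s eqs} => [|i s IH] ss dis; first by exists (fun=> 0).
have [ihead ss'] := shorter_head ss.
have [|c hc] := IH ss'.
  by move=> j k js ks; apply: dis; rewrite inE ?js ?ks orbT.
have [is_|nis] := boolP (i \in s).
  exists c => j k; rewrite !inE => js ks; apply: hc.
    by case/orP: js => [/eqP->|].
  by case/orP: ks => [/eqP->|].
suff [a ha] : exists a : 'I_7, {in s, forall j, c j = a -> apart i j}.
  exists (fun j => if j == i then a else c j) => j k; rewrite !inE.
  case: (eqVneq j i) => [->|ji] /= js; case: (eqVneq k i) => [->|ki] //= ks.
  - by move=> _ /esym; apply: ha.
  - by move=> _ ca; apply/apart_sym/ha.
  - exact: hc.
apply: contrapT => /forallNP nocol.
have conf a : exists j, [/\ j \in s, c j = a & ~ apart i j].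
  apply: contrapT => h; apply: (nocol a) => j js cja.
  by apply: contrapT => nij; apply: h; exists j.
have {conf} [f hf] := choice conf.
suff /leq_card : injective (fun a => conflict_code i (f a)).
  by rewrite card_prod card_bool !card_ord.
move=> a b; have [as_ ca na] := hf a; have [bs cb nb] := hf b.
have [fab|fab] := eqVneq (f a) (f b); first by rewrite -ca -cb fab.
have di j : j \in s -> r i <= l j \/ r j <= l i.
  move=> js; apply: dis; rewrite ?mem_head// ?inE ?js ?orbT//.
  by apply: contraNneq nis => ->.
move=> /conflict_code_inj []//; [exact: ihead|exact: ihead|exact: di|exact: di|].
by apply: dis => //; rewrite inE ?as_ ?bs orbT.
Qed.

(** Picks the weight of a new interval in [weights]; positivity of [hi] leaves room for a positive
    weight whatever [lo] is. *)
Lemma ex_between (lo hi : seq R) :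
  (forall a b, a \in lo -> b \in hi -> a <= b) -> all (> 0) hi ->
  exists q, [/\ 0 < q, all (<= q) lo & all (>= q) hi].
Proof.
elim: lo => [|a lo IH] lohi hi0.
  elim: hi hi0 {lohi} => [|b hi IH] /=; first by exists 1.
  move=> /andP[b0 /IH[q [q0 _ qhi]]]; exists (Num.min b q).
  split=> //; first by rewrite lt_min b0.
  rewrite ge_min lexx /=; apply: sub_all qhi => c /= qc.
  by rewrite /= ge_min qc orbT.
have [|q [q0 loq qhi]] := IH _ hi0.
  by move=> a' b a'lo bhi; apply: lohi; rewrite // inE a'lo orbT.
exists (Num.max a q); split=> /=.
- by rewrite lt_max q0 orbT.
- rewrite le_max lexx /=; apply: sub_all loq => c /= cq.
  by rewrite /= le_max cq orbT.
- apply/allP => b bhi; rewrite /= ge_max (allP qhi b bhi) andbT.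
  by apply: lohi; rewrite ?mem_head.
Qed.

(** Put [D = |x - e|], [U = |y - e|], [V = |x - x'|]. By the triangle inequality it suffices that
    [(U + D + V) D <= U V], that is [2 D^2 <= (U - D) (V - D)], and the right side is at least
    [(3/2)^2 D^2]. *)
Lemma far_points_swap (b x y e x' : R) : `|x - e| <= b ->
  5 / 2 * b <= `|y - e| -> 5 / 2 * b <= `|x - x'| ->
  `|y - x'| * `|x - e| <= `|y - e| * `|x - x'|.
Proof.
move=> xe ye xx'.
have : `|y - x'| <= `|y - e| + `|x - e| + `|x - x'|.
  rewrite (_ : y - x' = (y - e) - (x - e) + (x - x')); last by ring.
  by apply: le_trans (ler_normD _ _) _; rewrite lerD2r ler_normB.
move: (normr_ge0 (x - e)) (normr_ge0 (y - x')).
move: `|y - x'| `|x - e| `|y - e| `|x - x'| xe ye xx' => D B U V; nra.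
Qed.

(** Induction adding the shortest interval i last. Its weight has a lower bound for each end e of an
    old j, and an upper bound for each end e' of i and each old k. They are compatible: the
    induction hypothesis at e passes from j to k, and [far_points_swap] exchanges e and e'. *)
Lemma weights (C : eqType) (c : I -> C) (x : I -> R) s :
  (forall i, l i <= x i <= r i) ->
  {in s &, forall i j, i != j -> c i = c j -> apart i j} ->
  exists2 q : I -> R, (forall i, 0 < q i) &
    {in s &, forall i j, i != j -> c i = c j -> forall e, e \in [:: l j; r j] ->
      q j * `|x j - e| <= q i * `|x i - e|}.
Proof.
have [s' [ss' eqs]] := sorted_shorter s => xlr ap.
have {}ap : {in s' &, forall i j, i != j -> c i = c j -> apart i j}.
  by move=> i j; rewrite -!eqs; apply: ap.
suff [q q0 hq] : exists2 q : I -> R, (forall i, 0 < q i) &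
    {in s' &, forall i j, i != j -> c i = c j -> forall e, e \in [:: l j; r j] ->
      q j * `|x j - e| <= q i * `|x i - e|}.
  by exists q => // i j; rewrite !eqs; apply: hq.
elim: s' ss' ap {s eqs} => [|i s IH] ss ap; first by exists (fun=> 1).
have [ihead ss'] := shorter_head ss.
have [|q q0 hq] := IH ss'.
  by move=> j k js ks; apply: ap; rewrite inE ?js ?ks orbT.
have [is_|nis] := boolP (i \in s).
  exists q => // j k; rewrite !inE => js ks; apply: hq.
    by case/orP: js => [/eqP->|].
  by case/orP: ks => [/eqP->|].
pose s1 := [seq j <- s | c j == c i].
pose lo := [seq q j * `|x j - e| / `|x i - e| | j <- s1, e <- [:: l j; r j]].
(* An end equal to [x i] gives no constraint, since its left-hand side is 0; dropping it avoids a
   division by 0. *)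
pose hi := [seq q j * `|x j - e| / `|x i - e| |
  j <- s1, e <- [seq e <- [:: l i; r i] | e != x i]].
have endlr j e : e \in [:: l j; r j] -> l j <= e <= r j.
  by have /ltW := ltlr j; rewrite !inE => ? /orP[/eqP->|/eqP->]; rewrite lexx ?andbT.
have far j y z : j \in s1 -> l i <= y <= r i -> l j <= z <= r j ->
    5 / 2 * (r i - l i) <= `|y - z|.
  rewrite mem_filter => /andP[/eqP cji js] yi zj.
  rewrite -{1}(min_l (ihead _ js)); apply: ap yi zj => //.
  - by rewrite mem_head.
  - by rewrite inE js orbT.
  - by apply: contraNneq nis => ->.
have len0 : 0 < 5 / 2 * (r i - l i) by rewrite mulr_gt0 ?subr_gt0 ?ltlr//; lra.
have [a b /allpairsPdep[j [e [js ej ->]]] /allpairsPdep[k [e' [ks]]]||] :=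
    @ex_between lo hi.
- rewrite mem_filter => /andP[e'x e'i] ->.
  have xe := far j (x i) e js (xlr i) (endlr _ _ ej).
  have xk := far k (x i) (x k) ks (xlr i) (xlr k).
  have xk' := far k e' (x k) ks (endlr _ _ e'i) (xlr k).
  rewrite ler_pdivrMr; last exact: lt_le_trans xe.
  rewrite mulrAC ler_pdivlMr ?normr_gt0 ?subr_eq0 1?eq_sym//.
  have qjk : q j * `|x j - e| <= q k * `|x k - e|.
    have [->//|jk] := eqVneq j k.
    move: js ks; rewrite !mem_filter => /andP[/eqP cj js] /andP[/eqP ck ks].
    by apply: hq; rewrite ?ck ?cj// eq_sym.
  apply: le_trans (ler_wpM2r (normr_ge0 _) qjk) _.
  rewrite -!mulrA ler_pM2l//.
  apply: (far_points_swap (b := r i - l i)) xe => //; last by rewrite distrC.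
  have := xlr i; have := endlr i e' e'i => /andP[? ?] /andP[? ?].
  by rewrite ler_norml; apply/andP; split; lra.
- apply/allP => _ /allpairsPdep[k [e [ks ei ->]]].
  move: ei; rewrite mem_filter => /andP[ex ei].
  rewrite /= divr_gt0 ?mulr_gt0 ?normr_gt0 ?subr_eq0 1?eq_sym//.
  rewrite -subr_eq0 -normr_gt0; apply: lt_le_trans len0 _.
  exact: far (endlr _ _ ei) (xlr k).
move=> qi [qi0 loqi qihi].
exists (fun j => if j == i then qi else q j) => [j|j k]; first by case: ifP.
rewrite !inE.
case: (eqVneq j i) => [->|ji] /= js; case: (eqVneq k i) => [->|ki] //= ks.
- move=> _ cik e ek; rewrite -ler_pdivrMr; last first.
    apply: lt_le_trans len0 _; apply: (far k) => //; last exact: endlr.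
    by rewrite mem_filter -cik eqxx.
  apply: (allP loqi); apply/allpairsPdep; exists k, e; split=> //.
  by rewrite mem_filter -cik eqxx.
- move=> _ cji e ei.
  have [->|ex] := eqVneq e (x i).
    by rewrite subrr normr0 mulr0 mulr_ge0// ltW.
  rewrite -ler_pdivlMr ?normr_gt0 ?subr_eq0 1?eq_sym//.
  apply: (allP qihi); apply/allpairsPdep; exists j, e; split=> //.
    by rewrite mem_filter cji eqxx.
  by rewrite mem_filter ex.
- exact: hq.
Qed.

End Intervals.

(** * A factorization of the matrix (t_i - t_j)(t_i - t_(j+1)) *)

Section Factorization.
Variables (R : realFieldType) (tau : nat -> R) (s' : nat).
Local Notation s := s'.+1.
Hypothesis tau_lt : {homo tau : i j / (i < j)%N >-> i < j}.

(** A block extends to the first point of the next one, so that it contains every edge starting at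
    one of its points; neighbouring blocks share an end. *)
Definition left_end (j : 'I_s) := tau (j * s).
Definition right_end (j : 'I_s) := tau (j.+1 * s).
Definition block (i : nat) : 'I_s := inord (i %/ s).
Definition offset (i : nat) : 'I_s := inord (i %% s).
Definition point (g j : 'I_s) := tau (j * s + g).

Let tau_le : {homo tau : i j / (i <= j)%N >-> i <= j}.
Proof. by move=> i j; rewrite leq_eqVlt => /orP[/eqP->//|/tau_lt/ltW]. Qed.

Lemma end_lt j : left_end j < right_end j.
Proof. by rewrite /left_end /right_end tau_lt// ltn_mul2r ltnS leqnn. Qed.

Lemma blocks_disjoint : disjoint_itvs left_end right_end (enum 'I_s).
Proof.
move=> i j _ _ ij; have [lij|lji|/ord_inj eij] := ltngtP i j.
- by left; apply: tau_le; rewrite leq_mul2r lij orbT.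
- by right; apply: tau_le; rewrite leq_mul2r lji orbT.
- by rewrite eij eqxx in ij.
Qed.

Lemma point_in g j : left_end j <= point g j <= right_end j.
Proof.
rewrite !tau_le ?leq_addr// mulSn addnC leq_add2r; exact: ltnW.
Qed.

Lemma point_block_offset i : (i < s * s)%N -> point (offset i) (block i) = tau i.
Proof.
by move=> i_s; rewrite /point !inordK ?ltn_pmod ?ltn_divLR// -divn_eq.
Qed.

Lemma edge_in k : (k < s * s)%N ->
  left_end (block k) <= tau k /\ tau k.+1 <= right_end (block k).
Proof.
move=> k_s; rewrite /left_end /right_end inordK ?ltn_divLR//.
by split; apply: tau_le; [exact: leq_trunc_div|rewrite -ltn_divLR].
Qed.

Lemma edge_ge0 i k : 0 <= (tau i - tau k) * (tau i - tau k.+1).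
Proof.
have [ik|ki] := leqP i k.
  by rewrite mulr_le0 ?subr_le0 ?tau_le// (leq_trans ik).
by rewrite mulr_ge0 ?subr_ge0 ?tau_le// ltnW.
Qed.

Lemma outside_block i j : (i < s * s)%N -> block i != j ->
  tau i <= left_end j \/ right_end j <= tau i.
Proof.
move=> i_s ij; have /andP[] := point_in (offset i) (block i).
rewrite point_block_offset// => li ri.
have [|||h|h] := @blocks_disjoint (block i) j; rewrite ?mem_enum//.
  by left; apply: le_trans ri h.
by right; apply: le_trans h li.
Qed.

(* (x - l)^2, (x - l)(x - r), (x - r)^2 generate a cone that contains
   (x - a)(x - b) for all l <= a, b <= r. *)
Definition cone_gen (l r x : R) (h : 'I_3) : R :=
  [:: (x - l) ^+ 2; (x - l) * (x - r); (x - r) ^+ 2]`_h.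

(** Obtained by multiplying [x - a = ((r - a) (x - l) + (a - l) (x - r)) / (r - l)] by the same
    identity for b. *)
Definition cone_coef (l r a b : R) (h : 'I_3) : R :=
  [:: (r - a) * (r - b); (r - a) * (b - l) + (a - l) * (r - b);
      (a - l) * (b - l)]`_h / (r - l) ^+ 2.

Lemma cone_expansion l r a b x : l < r ->
  \sum_h cone_gen l r x h * cone_coef l r a b h = (x - a) * (x - b).
Proof.
move=> lr; rewrite !big_ord_recl big_ord0 /cone_gen /cone_coef /=.
by field; rewrite subr_eq0 gt_eqF.
Qed.

Lemma cone_coef_ge0 l r a b h : l <= a <= r -> l <= b <= r ->
  0 <= cone_coef l r a b h.
Proof.
move=> /andP[la ar] /andP[lb br]; rewrite mulr_ge0 ?invr_ge0 ?sqr_ge0//.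
case: h => -[|[|[|//]]] _ /=; rewrite ?addr_ge0// mulr_ge0// subr_ge0//.
Qed.

(** A coordinate [(a, g)] is shared by the g-th points of all blocks of colour a. It yields the
    entries inside a block, and an unwanted term between distinct blocks of one colour. The
    coordinates [(j, h)] yield the entries outside block j with that term subtracted. *)
Lemma edge_factorization :
  let K := ('I_7 * 'I_s + 'I_s * 'I_3)%type in
  exists (U : nat -> K -> R) (V : K -> nat -> R),
    [/\ forall i k, (i < s * s)%N -> 0 <= U i k,
        forall k j, (j < s * s)%N -> 0 <= V k j &
        forall i j, (i < s * s)%N -> (j < s * s)%N ->
          \sum_k U i k * V k j = (tau i - tau j) * (tau i - tau j.+1)].
Proof.
move=> K.
have [c hc] := coloring end_lt blocks_disjoint.
have /choice [q hq] : forall g, exists q : 'I_s -> R, (forall i, 0 < q i) /\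
    forall i j, i != j -> c i = c j ->
    forall e, e \in [:: left_end j; right_end j] ->
      q j * `|point g j - e| <= q i * `|point g i - e|.
  move=> g; have [q q0 hq] := weights end_lt (point_in g) hc.
  by exists q; split=> // i j; apply: hq; rewrite mem_enum.
(* Squared, since the outer cone generators are squares of the distances that [weights] compares. *)
pose w g j := q g j ^+ 2.
have w0 g j : 0 < w g j by rewrite exprn_gt0//; have [] := hq g.
pose rho g i j := if c i == c j then w g j / w g i else 0.
pose U i (k : K) := match k with
  | inl (a, g) => if (c (block i) == a) && (offset i == g)
                  then (w g (block i))^-1 else 0
  | inr (j, h) => if block i == j then 0 else
      cone_gen (left_end j) (right_end j) (tau i) h -
      rho (offset i) (block i) j *
        cone_gen (left_end j) (right_end j) (point (offset i) j) h
  end.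
pose V (k : K) e := match k with
  | inl (a, g) => if c (block e) == a then w g (block e) *
      ((point g (block e) - tau e) * (point g (block e) - tau e.+1)) else 0
  | inr (j, h) => if block e == j then
      cone_coef (left_end j) (right_end j) (tau e) (tau e.+1) h else 0
  end.
exists U, V; split.
- move=> i [[a g]|[j h]] i_s /=.
    by case: ifP => // _; rewrite invr_ge0 ltW.
  case: eqVneq => // ij; rewrite subr_ge0 /rho.
  have far : c (block i) = c j -> forall e, e \in [:: left_end j; right_end j] ->
      w (offset i) j / w (offset i) (block i) * (point (offset i) j - e) ^+ 2
      <= (tau i - e) ^+ 2.
    move=> cij e ej; rewrite mulrAC ler_pdivrMr// mulrC (mulrC (_ ^+ 2)).
    have [q0 /(_ _ _ ij cij e ej)] := hq (offset i).
    rewrite point_block_offset// /w => hqq.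
    rewrite -!exprMn -[leLHS]real_normK ?num_real// -[leRHS]real_normK ?num_real//.
    rewrite ler_sqr ?nnegrE// !normrM !(gtr0_norm (q0 _)).
    by rewrite -(mulrC `|tau i - e|) in hqq; rewrite // mulrC.
  have out := outside_block i_s ij.
  have /andP[pl pr] := point_in (offset i) j.
  case: h => -[|[|[|//]]] h3; rewrite /cone_gen /=.
  + by case: eqP => [/far|_]; [apply; rewrite inE eqxx|rewrite mul0r sqr_ge0].
  (* The middle generator is nonnegative outside block j and nonpositive at a point of block j, so 0
     separates the two terms. *)
  + apply: (@le_trans _ _ 0); last first.
      have := end_lt j; case: out => ? ?; [apply: mulr_le0|apply: mulr_ge0]; lra.
    rewrite mulr_ge0_le0//; last by rewrite mulr_ge0_le0 ?subr_ge0 ?subr_le0.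
    by case: ifP => // _; rewrite divr_ge0 ?ltW.
  + by case: eqP => [/far|_]; [apply; rewrite !inE eqxx orbT|rewrite mul0r sqr_ge0].
- move=> [[a g]|[j h]] e e_s /=; case: ifP => //.
    by rewrite mulr_ge0 ?edge_ge0// ltW.
  move=> /eqP <-; have [le re] := edge_in e_s; have ? := tau_lt (ltnSn e).
  by apply: cone_coef_ge0; apply/andP; split=> //; lra.
move=> i e i_s e_s; rewrite big_sumType /=.
rewrite (bigD1 (c (block i), offset i))//= !eqxx /= big1 ?addr0; last first.
  move=> [a g]; rewrite xpair_eqE negb_and /= => /orP[]; rewrite eq_sym => /negbTE->;
  by rewrite ?andbF mul0r.
rewrite [X in _ + X](_ : _ =
    \sum_j \sum_h U i (inr (j, h)) * V (inr (j, h)) e); last first.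
  by rewrite pair_bigA; apply: eq_bigr => -[].
rewrite /=.
rewrite (bigD1 (block e))//= [X in _ + (_ + X)]big1 ?addr0; last first.
  by move=> j; rewrite eq_sym => /negbTE je; apply: big1 => h _; rewrite je mulr0.
(* In the same block only the shared coordinate contributes. Otherwise its contribution at y,
   present only for equal colours, is what the cone coordinates subtract. *)
rewrite eqxx; set y := point _ (block e); have [ie|ie] := eqVneq (block i) (block e).
  rewrite [X in _ + X]big1 => [|h _]; last by rewrite mul0r.
  rewrite addr0 ie eqxx mulrA mulVf ?mul1r ?gt_eqF// /y -ie.
  by rewrite point_block_offset.
under eq_bigr do rewrite mulrBl -mulrA.
rewrite big_split /= sumrN -mulr_sumr !cone_expansion ?end_lt// /rho.
rewrite eq_sym; case: eqP => _; last by rewrite mulr0 mul0r subr0 add0r.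
by rewrite mulrCA mulrA addrC subrK.
Qed.

End Factorization.

(** * Polyhedra and their facets *)

Section ConvexHull.
Variables (R : realType) (d : nat).
Implicit Types (x y z v : 'rV[R]_d) (a : 'cV[R]_d) (A C : set 'rV[R]_d).

Definition dot x a : R := (x *m a) 0 0.

Lemma dotD x y a : dot (x + y) a = dot x a + dot y a.
Proof. by rewrite /dot mulmxDl mxE. Qed.

Lemma dotZ t x a : dot (t *: x) a = t * dot x a.
Proof. by rewrite /dot -scalemxAl mxE. Qed.

Lemma dotN x a : dot (- x) a = - dot x a.
Proof. by rewrite -scaleN1r dotZ mulN1r. Qed.

Lemma dotDr x a b : dot x (a + b) = dot x a + dot x b.
Proof. by rewrite /dot mulmxDr mxE. Qed.

Lemma dotZr t x a : dot x (t *: a) = t * dot x a.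
Proof. by rewrite /dot -scalemxAr mxE. Qed.

Lemma dot_delta x i : dot x (delta_mx i 0) = x 0 i.
Proof. by rewrite /dot -colE mxE. Qed.

Lemma convex_setP C : convex_set C <->
  (forall x y t, 0 <= t <= 1 -> C x -> C y -> C (t *: x + (1 - t) *: y)).
Proof.
split=> [cC x y t /andP[t0 t1] Cx Cy|cC x y t].
  have := cC x y (Itv01 t0 t1); rewrite !inE; exact.
rewrite !inE => Cx Cy; apply: cC => //.
by rewrite ge0 le1.
Qed.

Lemma sub_conv_hull A : A `<=` conv_hull A.
Proof. exact: sub_gen_smallest. Qed.

Lemma conv_hull_min A C : convex_set C -> A `<=` C -> conv_hull A `<=` C.
Proof. exact: smallest_sub. Qed.

Lemma conv_hull_convex A : convex_set (conv_hull A).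
Proof.
apply/convex_setP => x y t t01 Ax Ay C [cC AC].
by have /convex_setP := cC; apply=> //; [apply: Ax|apply: Ay].
Qed.

Lemma convex_halfspace a (b : R) : convex_set [set x | dot x a <= b].
Proof.
apply/convex_setP => x y t /andP[t0 t1] /= xb yb.
rewrite dotD !dotZ; nra.
Qed.

Lemma conv_hull_bounded A a : finite_set A ->
  exists M, forall x, conv_hull A x -> dot x a <= M.
Proof.
move=> /finite_seqP[s ->]; exists (\sum_(y <- s) `|dot y a|).
apply: conv_hull_min; first exact: convex_halfspace.
move=> y /= ys; apply: le_trans (ler_norm _) _.
by rewrite (big_rem y)//= lerDl sumr_ge0.
Qed.

End ConvexHull.

(** * Affine dimension and hyperplanes *)

Section AffineDimension.
Variables (R : realType) (d : nat).
Implicit Types (S T : set 'rV[R]_d).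

Lemma affdim_ge S k (X : 'M[R]_(k, d)) :
  affinely_independent X -> (forall i, S (row i X)) -> k%:Z - 1 <= affdim S.
Proof.
move=> Xfree XS; rewrite lerD2r lez_nat.
have kd : (k < d.+2)%N.
  by have := rank_leq_col (row_mx X (const_mx 1 : 'cV_k));
     rewrite (eqP Xfree) addn1.
apply: (leq_bigmax_cond (Ordinal kd)) => /=.
by apply/asboolP; exists X.
Qed.

Lemma affdim_witness S : exists k (X : 'M[R]_(k, d)),
  [/\ affinely_independent X, forall i, S (row i X) & affdim S = k%:Z - 1].
Proof.
pose p (k : 'I_d.+2) := `[< exists X : 'M[R]_(k, d),
  affinely_independent X /\ forall i, S (row i X) >].
have [|k kp kmax] := @eq_bigmax_cond _ p (fun k => k).
  (* The empty family is admissible, so the maximum is attained. *)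
  apply/card_gt0P; exists ord0; apply/asboolP; exists 0; split=> [|[]//].
  by rewrite /affinely_independent /row_free mxrank_eq0 flatmx0.
have dS : affdim S = (\max_(k in p) k)%:Z - 1 by [].
by rewrite dS kmax; move: kp => /asboolP[X [? ?]]; exists k, X.
Qed.

Lemma affdim_mono S T : S `<=` T -> affdim S <= affdim T.
Proof.
move=> ST; have [k [X [Xfree XS ->]]] := affdim_witness S.
by apply: affdim_ge Xfree _ => i; apply/ST.
Qed.

(** Take a largest affinely independent family X in S. A point of T outside its affine span could be
    appended to X, making [affdim T] too large; so T lies in the span of X, where the equation
    persists. *)
Lemma affdim_eq_hyperplane S T (a : 'cV[R]_d) (b : R) : S `<=` T ->
  affdim S = affdim T -> (forall x, S x -> dot x a = b) ->
  forall x, T x -> dot x a = b.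
Proof.
move=> ST dST Sab y Ty.
have [k [X [Xfree XS dS]]] := affdim_witness S.
pose B := row_mx X (const_mx 1 : 'cV[R]_k).
pose u := row_mx y (const_mx 1 : 'cV[R]_1).
have [/submxP[D]|uB] := boolP (u <= B)%MS.
  rewrite /u /B mul_mx_row => /eq_row_mx[-> D1].
  have Xa : X *m a = b *: const_mx 1.
    apply/colP => i; rewrite !mxE mulr1 -(Sab _ (XS i)) /dot !mxE.
    by apply: eq_bigr => j _; rewrite !mxE.
  by rewrite /dot -mulmxA Xa -scalemxAr -D1 !mxE mulr1.
have: (k.+1%:Z - 1 <= affdim T)%R.
  rewrite -addn1; apply: (@affdim_ge _ _ (col_mx X y)); last first.
    move=> i; case: (split_ordP i) => j ->.
      have -> : row (lshift 1 j) (col_mx X y) = row j X.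
        by apply/rowP => c; rewrite !mxE (unsplitK (inl j)).
      exact: ST (XS j).
    have -> : row (rshift k j) (col_mx X y) = y; last by [].
    by apply/rowP => c; rewrite !mxE (unsplitK (inr j)) ord1.
  rewrite /affinely_independent.
  have -> : row_mx (col_mx X y) (const_mx 1) = col_mx B u.
    by rewrite -block_mxEv -col_mx_const -block_mxEh.
  have ltB : (\rank B < \rank (col_mx B u))%N.
    apply: rank_ltmx; rewrite ltmxE col_mx_sub (negbTE uB) andbF andbT.
    by rewrite -addsmxE addsmxSl.
  by rewrite /row_free eqn_leq rank_leq_row; rewrite (eqP Xfree) -addn1 in ltB.
by rewrite -dST dS lerD2r lez_nat ltnn.
Qed.

Lemma affdim_set0 : affdim (set0 : set 'rV[R]_d) = -1.
Proof.
have [[|k] [X [_ XS ->]]] := affdim_witness set0; first by [].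
by have := XS 0.
Qed.

Lemma affdim_eq0 S x y : S x -> S y -> affdim S = 0 -> x = y.
Proof.
move=> Sx Sy dS.
have x0 : 0 <= affdim [set x].
  rewrite -(_ : 1%:Z - 1 = 0)//; apply: (@affdim_ge _ _ x); last first.
    by move=> i; apply/rowP => j; rewrite !mxE ord1.
  rewrite /affinely_independent /row_free eqn_leq rank_leq_row lt0n mxrank_eq0.
  apply/eqP => /matrixP/(_ 0 (rshift d 0)); rewrite row_mxEr !mxE.
  by move/eqP; rewrite oner_eq0.
have sS : [set x] `<=` S by move=> _ ->.
have dE : affdim [set x] = affdim S.
  by apply/eqP; rewrite eq_le affdim_mono//= dS.
apply/rowP => j; rewrite -!dot_delta; apply/esym.
by apply: (affdim_eq_hyperplane sS dE) => // _ ->.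
Qed.

End AffineDimension.

(** The smallest ratio [f k / g k] over the k with [0 < g k] serves. It bounds how far one can move
    before a slack f, decreasing at rate g, becomes negative. *)
Lemma small_multiplier (R : realFieldType) (T : eqType) (s : seq T) (f g : T -> R) :
  {in s, forall k, 0 < f k \/ 0 <= f k /\ g k <= 0} ->
  exists2 e, 0 < e & {in s, forall k, e * g k <= f k}.
Proof.
elim: s => [|k s IH] fg; first by exists 1.
have [|e e0 es] := IH; first by move=> i si; apply: fg; rewrite inE si orbT.
have [e' [e'0 e'e ke']] : exists e', [/\ 0 < e', e' <= e & e' * g k <= f k].
  have [gk|gk] := leP (g k) 0.
    exists e; split=> //; apply: (@le_trans _ _ 0); first by rewrite mulr_ge0_le0// ltW.
    by have [/ltW|[]//] := fg k (mem_head _ _).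
  have fk : 0 < f k by have [//|[_]] := fg k (mem_head _ _); rewrite leNgt gk.
  exists (Num.min e (f k / g k)); rewrite lt_min e0 divr_gt0//= ge_min lexx/=.
  by split=> //; rewrite -ler_pdivlMr// ge_min lexx orbT.
exists e' => // i; rewrite inE => /orP[/eqP->//|si].
have [gi|gi] := leP (g i) 0; last by apply: le_trans (es i si); rewrite ler_pM2r.
apply: (@le_trans _ _ 0); first by rewrite mulr_ge0_le0// ltW.
have [|/ltW//|[]//] := fg i; by rewrite inE si orbT.
Qed.

(** * Extreme points and facets of a polyhedron *)

Section Polyhedron.
Variables (R : realType) (d : nat) (J : Type) (K : finType).
Variables (L : J -> 'cV[R]_d) (b : J -> R) (G : K -> 'cV[R]_d).

Definition polyhedron : set 'rV[R]_d :=
  [set z | (forall j, dot z (L j) = b j) /\ forall k, 0 <= dot z (G k)].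

(** Extremality in the form of basic solutions: the equations and the tight inequalities leave no
    direction of movement. *)
Definition extreme_points : set 'rV[R]_d :=
  [set z | polyhedron z /\ forall v, (forall j, dot v (L j) = 0) ->
    (forall k, dot z (G k) = 0 -> dot v (G k) = 0) -> v = 0].

Let tight (z : 'rV[R]_d) : {set K} := [set k | dot z (G k) == 0]%SET.

(** An extreme point is determined by its set of tight inequalities, because the difference of two
    with the same set is a forbidden direction. *)
Lemma finite_extreme_points : finite_set extreme_points.
Proof.
pose f (T : {set K}) := xget 0 [set z | extreme_points z /\ tight z = T].
apply: (@sub_finite_set _ _ (range f)); last exact/finite_image/finite_finset.
move=> z ez; exists (tight z) => //; rewrite /f.
case: xgetP => [_ -> [[Qz' _] tz'] |/(_ z)[]//].
case: ez => Qz exz; set z' := xget _ _ in Qz' tz' *.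
suff : z' - z = 0 by move/subr0_eq.
apply: exz => [j|k zk]; rewrite dotD dotN.
  by rewrite (proj1 Qz') (proj1 Qz) subrr.
have : k \in tight z by rewrite inE zk.
by rewrite -tz' inE zk subr0 => /eqP.
Qed.

Lemma convex_polyhedron : convex_set polyhedron.
Proof.
apply/convex_setP => x y t /andP[t0 t1] [xL xG] [yL yG]; split=> [j|k].
  by rewrite dotD !dotZ xL yL; ring.
by rewrite dotD !dotZ addr_ge0// mulr_ge0// subr_ge0.
Qed.

(** The ratio test of the simplex method: [F k] is the time at which inequality k becomes tight, and
    the ray stops at the smallest one. *)
Lemma ray_exit z v : polyhedron z -> (forall j, dot v (L j) = 0) ->
  (forall k, dot z (G k) = 0 -> dot v (G k) = 0) ->
  (exists k, dot v (G k) < 0) ->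
  exists t, [/\ 0 < t, polyhedron (z + t *: v) & tight z \proper tight (z + t *: v)].
Proof.
move=> [zL zG] vL vtight [k0 k0v].
pose F k := dot z (G k) / - dot v (G k).
have [k kv kmin] := @arg_minP _ R K k0 (fun k => dot v (G k) < 0) F k0v.
have zk : 0 < dot z (G k).
  by rewrite lt_neqAle zG eq_sym andbT; apply: contraTneq kv => /vtight ->; rewrite ltxx.
exists (F k); split.
- by rewrite divr_gt0 ?oppr_gt0.
- split=> [j|i]; rewrite dotD dotZ; first by rewrite vL mulr0 addr0.
  have [vi|vi] := leP 0 (dot v (G i)).
    by rewrite addr_ge0// mulr_ge0// ltW// /F divr_gt0 ?oppr_gt0.
  have : F k <= F i := kmin i vi.
  by rewrite [X in _ <= X]/F ler_pdivlMr ?oppr_gt0// mulrN -subr_ge0 opprK.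
- apply/properP; split.
    apply/fintype.subsetP => i; rewrite !inE => /eqP zi.
    by rewrite dotD dotZ zi vtight// mulr0 addr0.
  exists k; rewrite inE; last by rewrite gt_eqF.
  rewrite dotD dotZ /F invrN mulrN mulNr divfK ?subrr//.
  by rewrite lt_eqF.
Qed.

Hypothesis no_ray : forall v, (forall j, dot v (L j) = 0) ->
  (forall k, 0 <= dot v (G k)) -> v = 0.

(** Induction on the number of inequalities that are not tight. A point that is not extreme lies
    between its exit points in directions v and -v, which exist as the recession cone is trivial,
    and more inequalities are tight there. *)
Lemma polyhedron_conv_hull : polyhedron = conv_hull extreme_points.
Proof.
apply/seteqP; split; last first.
  by apply: conv_hull_min => [|z []//]; exact: convex_polyhedron.
move=> z; have [n] := ubnP #|~: tight z|%SET.
elim: n z => // n IH z; rewrite ltnS => zn Qz.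
have [ez|nez] := pselect (extreme_points z); first exact: sub_conv_hull.
have [v [vL vtight v0]] : exists v, [/\ forall j, dot v (L j) = 0,
    forall k, dot z (G k) = 0 -> dot v (G k) = 0 & v != 0].
  apply: contrapT => h; apply: nez; split=> // v vL vt.
  by apply: contrapT => /eqP v0; apply: h; exists v.
have step u : u != 0 -> (forall j, dot u (L j) = 0) ->
    (forall k, dot z (G k) = 0 -> dot u (G k) = 0) ->
    exists2 t, 0 < t & conv_hull extreme_points (z + t *: u).
  move=> u0 uL ut; have [|t [t0 Qt pt]] := ray_exit Qz uL ut.
    apply: contrapT => h; move/eqP: u0; apply; apply: no_ray => // k.
    by rewrite leNgt; apply/negP => ku; apply: h; exists k.
  exists t => //; apply: IH => //; apply: leq_trans zn.
  by apply: proper_card; rewrite properC.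
have [t t0 Ct] := step v v0 vL vtight.
have [|||t' t'0 Ct'] := step (- v); rewrite ?oppr_eq0//.
- by move=> j; rewrite dotN vL oppr0.
- by move=> k /vtight vk; rewrite dotN vk oppr0.
have tt' : 0 < t + t' by rewrite addr_gt0.
have -> : z = (t' / (t + t')) *: (z + t *: v) +
              (1 - t' / (t + t')) *: (z + t' *: - v).
  apply/rowP => i; rewrite !mxE; field; exact: lt0r_neq0.
apply: (proj1 (convex_setP _) (@conv_hull_convex _ _ _)) => //.
apply/andP; split; first by rewrite divr_ge0 ?ltW.
by rewrite ler_pdivrMr// mul1r lerDr ltW.
Qed.

Lemma polytope_polyhedron : polytope polyhedron.
Proof.
by exists extreme_points; [exact: finite_extreme_points|exact: polyhedron_conv_hull].
Qed.

Definition ineq_face (k : K) := [set z | polyhedron z /\ dot z (G k) = 0].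

(** Some inequality k is tight on F but not on the whole polyhedron: otherwise F would contain a
    relative interior point of the polyhedron. Then F lies in [ineq_face k], a proper face, and
    equality follows by comparing dimensions. *)
Lemma facet_ineq_face F x y : polyhedron x -> polyhedron y -> x <> y ->
  facet polyhedron F -> exists k, F = ineq_face k.
Proof.
move=> Qx Qy xy [[a [c [Qac FE]]] dF].
have FQ : F `<=` polyhedron by rewrite FE => z [].
have Fa z : F z -> dot z a = c by rewrite FE => -[].
(* The empty face of a single point counts as a facet; two distinct points exclude this case. *)
have dQ0 : affdim polyhedron != 0.
  by apply/eqP => dQ; apply: xy; apply: affdim_eq0 dQ.
have [f0 Ff0] : F !=set0.
  apply/set0P; apply: contra_neqN dQ0 => /eqP F0.
  by move: dF; rewrite F0 affdim_set0 => /eqP; rewrite eq_sym subr_eq addNr => /eqP.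
have [z1 [Qz1 z1c]] : exists z, polyhedron z /\ dot z a < c.
  apply: contrapT => h; have FQE : F = polyhedron.
    apply/seteqP; split=> // z Qz; rewrite FE; split=> //.
    apply/eqP; rewrite eq_le Qac//= leNgt; apply/negP => zc.
    by apply: h; exists z.
  by move/eqP: dF; rewrite FQE eq_sym subr_eq addrC eq_sym -subr_eq0 addrK.
have [k [kF [z2 [Qz2 z2k]]]] : exists k, (forall z, F z -> dot z (G k) = 0) /\
    exists z, polyhedron z /\ dot z (G k) <> 0.
  apply: contrapT => h.
  have inner k : (exists2 z, F z & 0 < dot z (G k)) \/
      forall z, polyhedron z -> dot z (G k) = 0.
    have [|nk] := pselect (forall z, polyhedron z -> dot z (G k) = 0); first by right.
    left; apply: contrapT => nF; apply: h; exists k; split.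
      move=> z Fz; apply/eqP; rewrite eq_le (proj2 (FQ _ Fz)) andbT leNgt.
      by apply/negP => zk; apply: nF; exists z.
    apply: contrapT => nz; apply: nk => z Qz.
    by apply: contrapT => zk; apply: nz; exists z.
  (* A point in the relative interior of F, hence of the polyhedron. *)
  have [z0 [Fz0 z0k]] : exists z, F z /\ forall k, k \in enum K ->
      0 < dot z (G k) \/ forall z, polyhedron z -> dot z (G k) = 0.
    elim: (enum K) => [|k s [z [Fz zs]]]; first by exists f0.
    have [[z' Fz' z'k]|all0] := inner k; last first.
      by exists z; split=> // i; rewrite inE => /orP[/eqP->|/zs//]; right.
    exists ((1 / 2) *: z + (1 - 1 / 2) *: z'); split.
      rewrite FE; split.
        apply: (proj1 (convex_setP _) convex_polyhedron); [lra| |]; exact: FQ.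
      by rewrite -/(dot _ a) dotD !dotZ !Fa//; lra.
    have zi i := proj2 (FQ _ Fz) i; have z'i i := proj2 (FQ _ Fz') i.
    move=> i; rewrite inE dotD !dotZ => /orP[/eqP->|/zs[zi0|]]; last by right.
      by left; move: (zi k) => ?; lra.
    by left; move: (z'i i) => ?; lra.
  (* Moving from [z0] slightly away from [z1] stays in the polyhedron but raises the value of a
     above c. *)
  have [k|e e0 ez] := @small_multiplier R K (enum K) (fun k => dot z0 (G k))
      (fun k => dot (z1 - z0) (G k)).
    move=> /z0k[|Qk]; first by left.
    by right; rewrite dotD dotN !Qk ?subrr//; exact: FQ.
  have /Qac : polyhedron (z0 - e *: (z1 - z0)).
    split=> [j|k]; rewrite dotD dotN dotZ.
      by rewrite dotD dotN (proj1 Qz1) (proj1 (FQ _ Fz0)) subrr mulr0 subr0.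
    by rewrite subr_ge0 ez ?mem_enum.
  rewrite -/(dot _ a) dotD dotN dotZ dotD dotN (Fa _ Fz0); nra.
have FFk : F `<=` ineq_face k by move=> z Fz; split; [exact: FQ|exact: kF].
have dk : affdim F = affdim (ineq_face k).
  apply/eqP; rewrite eq_le affdim_mono//= dF lerBrDr -ltzD1 ltrD2r.
  rewrite lt_neqAle affdim_mono ?andbT => [|z []//].
  apply: contra_notN z2k => /eqP dE.
  by apply: (affdim_eq_hyperplane _ dE) => // z [].
exists k; apply/seteqP; split=> // z kz; rewrite FE; split; first by case: kz.
exact: (affdim_eq_hyperplane FFk dk).
Qed.

End Polyhedron.

(** * Upper bounds on extension complexity *)

Section ExtensionComplexity.
Variables (R : realType) (e : nat) (P : set 'rV[R]_e).

(** Each facet is [ineq_face k] for some k, so there are at most [#|K|]. The distinct points x and y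
    lift to distinct points of the polyhedron, as [facet_ineq_face] requires. *)
Lemma xc_le_polyhedron d J (K : finType) (L : J -> 'cV[R]_d) b (G : K -> 'cV[R]_d)
    (f : {linear 'rV[R]_d -> 'rV[R]_e}) x y :
  (forall v, (forall j, dot v (L j) = 0) -> (forall k, 0 <= dot v (G k)) -> v = 0) ->
  P = f @` polyhedron L b G -> P x -> P y -> x <> y ->
  (xc P <= (#|K|%:R)%:E)%E.
Proof.
set Q := polyhedron L b G => no_ray PfQ Px Py xy.
have facets : facet Q `<=` range (ineq_face L b G).
  move: Px Py; rewrite PfQ => -[x' Qx' x'x] [y' Qy' y'y] F facF.
  have [|k ->] := @facet_ineq_face _ _ _ _ L b G F x' y' Qx' Qy' _ facF.
    by move=> x'y'; apply: xy; rewrite -x'x -y'y x'y'.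
  by exists k.
have /finite_setP[m cm] : finite_set (facet Q).
  exact/(sub_finite_set facets)/finite_image/finite_finset.
have mK : (m <= #|K|)%N.
  rewrite -card_le_II -(card_le_eql cm).
  apply: card_le_trans (subset_card_le facets) _.
  apply: card_le_trans (card_image_le _ _) _.
  suff h : set_bij [set: K] `I_#|K| (fun k => enum_rank k : nat).
    have : [set: K] #= `I_#|K| by apply/card_set_bijP; exists (fun k => enum_rank k : nat).
    by move=> /card_eqPle[].
  split=> [k _ /=|k k' _ _ /ord_inj/enum_rank_inj//|i /= iK]; first exact: ltn_ord.
  by exists (enum_val (Ordinal iK)) => //; rewrite enum_valK.
apply: (@le_trans _ _ (m%:R)%:E); last by rewrite lee_fin ler_nat.
apply: ereal_inf_lbound; exists m => //; exists d, Q; split=> //.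
split; [exact: polytope_polyhedron|by exists f].
Qed.

(* Yannakakis' factorization theorem; [U] and [V] factor the slack matrix. *)
Lemma xc_le_factorization (I : finType) (J : Type) (j0 : J) r (p : I -> 'rV[R]_e)
    (a : J -> 'cV[R]_e) (c : J -> R) (U : I -> 'I_r -> R) (V : 'I_r -> J -> R) x1 x2 :
  P = conv_hull (range p) -> P = [set x | forall j, 0 <= dot x (a j) + c j] ->
  (forall i k, 0 <= U i k) -> (forall k j, 0 <= V k j) ->
  (forall i j, dot (p i) (a j) + c j = \sum_k U i k * V k j) ->
  P x1 -> P x2 -> x1 <> x2 ->
  (xc P <= (r%:R)%:E)%E.
Proof.
move=> Pp Pac.
(* Rows V k that vanish identically are made positive, to keep y bounded. *)
wlog Vpos : U V / forall k, exists j, 0 < V k j.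
  move=> gen U0 V0 UV.
  pose z k := `[< exists j, 0 < V k j >].
  apply: (gen (fun i k => if z k then U i k else 0) (fun k j => if z k then V k j else 1)).
  - move=> k; rewrite /z; case: asboolP => [//|_]; first by exists j0; exact: ltr01.
  - by move=> i k; case: ifP.
  - by move=> k j; case: ifP => // _; exact: ler01.
  move=> i j; rewrite UV; apply: eq_bigr => k _; rewrite /z; case: asboolP => // nz.
  rewrite mul0r; have [Vkj|Vkj] := leP (V k j) 0; last by case: nz; exists j.
  by rewrite (_ : V k j = 0) ?mulr0//; apply/eqP; rewrite eq_le Vkj V0.
move=> U0 V0 UV Px1 Px2 x12.
(* The extension consists of the pairs (x, y) with [y >= 0] and
   [dot x (a j) + c j = \sum_k y_k V k j] for all j; only the r signs of y are inequalities. *)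
pose L j : 'cV[R]_(e + r) := col_mx (a j) (- \col_k V k j).
pose G (k : 'I_r) : 'cV[R]_(e + r) := col_mx 0 (delta_mx k 0).
have dotL x y j : dot (row_mx x y) (L j) = dot x (a j) - \sum_k y 0 k * V k j.
  rewrite /dot mul_row_col mulmxN !mxE; congr (_ - _).
  by apply: eq_bigr => k _; rewrite !mxE.
have dotG x y k : dot (row_mx x y) (G k) = y 0 k.
  by rewrite /dot mul_row_col mulmx0 add0r -/(dot _ _) dot_delta.
pose f : {linear 'rV[R]_(e + r) -> 'rV[R]_e} := mulmxr (col_mx 1%:M 0).
have fE x y : f (row_mx x y) = x by rewrite /= mul_row_col mulmx1 mulmx0 addr0.
have PfQ : P = f @` polyhedron L (fun j => - c j) G.
  apply/seteqP; split.
    rewrite {1}Pp; apply: conv_hull_min.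
      apply/convex_setP => _ _ t t01 [x Qx <-] [y Qy <-].
      exists (t *: x + (1 - t) *: y); last by rewrite linearD !linearZ.
      exact: (proj1 (convex_setP _) (@convex_polyhedron _ _ _ _ _ _ _)).
    move=> _ [i _ <-]; exists (row_mx (p i) (\row_k U i k)) => //; split=> [j|k].
      apply/eqP; rewrite dotL -subr_eq0 opprK addrAC UV subr_eq0; apply/eqP.
      by apply: eq_bigr => k _; rewrite mxE.
    by rewrite dotG mxE.
  move=> _ [z [zL zG] <-]; rewrite -(hsubmxK z) fE in zL zG *.
  rewrite Pac => j; move: (zL j); rewrite dotL => /(canRL (subrK _)) ->.
  rewrite addrAC addNr add0r sumr_ge0// => k _; rewrite mulr_ge0//.
  by move: (zG k); rewrite dotG.
rewrite -[r in r%:R]card_ord.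
apply: (xc_le_polyhedron _ PfQ Px1 Px2 x12) => v vL vG.
move: vL vG; rewrite -(hsubmxK v); move: (lsubmx v) (rsubmx v) => x y xyL xyG.
have y0 k : 0 <= y 0 k by rewrite -(dotG x).
have xa j : dot x (a j) = \sum_k y 0 k * V k j.
  by apply/eqP; rewrite -subr_eq0 -dotL xyL.
(* A recession direction (x, y) of the extension makes x a recession direction of P, which is
   bounded. *)
have x0 : x = 0.
  have ray s : 0 <= s -> P (x1 + s *: x).
    move=> s0; rewrite Pac => j; rewrite dotD dotZ addrAC addr_ge0//.
      by move: Px1; rewrite Pac; apply.
    by rewrite mulr_ge0// xa sumr_ge0// => k _; rewrite mulr_ge0.
  have le0 w : dot x w <= 0.
    have [|M PM] := @conv_hull_bounded _ _ (range p) w.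
      exact/finite_image/finite_finset.
    rewrite leNgt; apply/negP => xw0.
    have M1 : dot x1 w <= M by apply: PM; rewrite -Pp.
    (* This multiple of x takes w to the value M + 1, above its bound M. *)
    have s0 : 0 <= (M - dot x1 w + 1) / dot x w.
      by rewrite divr_ge0 ?ltW// ltr_wpDl ?subr_ge0.
    have /PM : conv_hull (range p) (x1 + ((M - dot x1 w + 1) / dot x w) *: x).
      by rewrite -Pp; apply: ray.
    by rewrite dotD dotZ divfK ?gt_eqF//; lra.
  apply/rowP => i; rewrite mxE -dot_delta; apply/eqP; rewrite eq_le le0/=.
  by have := le0 (- delta_mx i 0); rewrite -scaleN1r dotZr mulN1r oppr_le0.
suff -> : y = 0 by rewrite x0 row_mx0.
apply/rowP => k; rewrite mxE; have [j Vkj] := Vpos k.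
have := xa j; rewrite x0 /dot mul0mx mxE => /esym/eqP.
rewrite psumr_eq0 => [|k' _]; last by rewrite mulr_ge0.
by move=> /allP/(_ k (mem_index_enum _)); rewrite mulf_eq0 (gt_eqF Vkj) orbF => /eqP.
Qed.

End ExtensionComplexity.

(** * Inscribed polygons *)

Section Plane.
Variable R : realType.
Implicit Types (x y v : 'rV[R]_2) (f : 'cV[R]_2).

Lemma dot2 x f : dot x f = x 0 0 * f 0 0 + x 0 1 * f 1 0.
Proof.
rewrite /dot mxE big_ord_recl big_ord1.
by congr (_ + _ * _); congr (_ _ _); apply/val_inj.
Qed.

Lemma row2P x y : x 0 0 = y 0 0 -> x 0 1 = y 0 1 -> x = y.
Proof.
move=> h0 h1; apply/rowP => i; case: (unliftP 0 i) => [j ->|->//].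
by rewrite (_ : lift 0 j = 1)//; apply/val_inj; rewrite /= ord1.
Qed.

Lemma seq_argmax (T : eqType) (s : seq T) (F : T -> R) (a : T) : a \in s ->
  exists2 m, m \in s & {in s, forall b, F b <= F m}.
Proof.
elim: s a => // y s IH a _; have [->|s0] := eqVneq s [::].
  by exists y; rewrite ?mem_head// => z; rewrite inE => /eqP->.
have [m ms hm] : exists2 m, m \in s & {in s, forall b, F b <= F m}.
  by case: s s0 IH => // z s _ IH; apply: (IH z); rewrite mem_head.
have [my|/ltW ym] := leP (F m) (F y).
  exists y; rewrite ?mem_head// => z; rewrite inE => /orP[/eqP->//|/hm zm].
  exact: le_trans my.
exists m; rewrite ?inE ?ms ?orbT// => z; rewrite inE => /orP[/eqP->//|]; exact: hm.
Qed.

Definition rot f : 'cV[R]_2 := \col_i (if i == 0 then - f 1 0 else f 0 0).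

Lemma sqnorm_neq0 f : f != 0 -> f 0 0 ^+ 2 + f 1 0 ^+ 2 != 0.
Proof.
move=> f0; apply: contraNneq f0 => /eqP; rewrite paddr_eq0 ?sqr_ge0// !sqrf_eq0.
move=> /andP[/eqP f00 /eqP f10]; apply/eqP/colP => i; rewrite mxE.
case: (unliftP 0 i) => [j ->|->//].
by rewrite (_ : lift 0 j = 1)//; apply/val_inj; rewrite /= ord1.
Qed.

Lemma dot_rot_inj f x y : f != 0 -> dot x f = dot y f -> dot x (rot f) = dot y (rot f) ->
  x = y.
Proof.
move=> f0 h1 h2.
have {}h1 : dot x f - dot y f = 0 by rewrite h1 subrr.
have {}h2 : dot x (rot f) - dot y (rot f) = 0 by rewrite h2 subrr.
rewrite !dot2 in h1; rewrite !dot2 !mxE /= in h2.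
have n0 := sqnorm_neq0 f0.
pose g := x 0 0 * f 0 0 + x 0 1 * f 1 0 - (y 0 0 * f 0 0 + y 0 1 * f 1 0).
pose k := x 0 0 * - f 1 0 + x 0 1 * f 0 0 - (y 0 0 * - f 1 0 + y 0 1 * f 0 0).
have e1 : (x 0 0 - y 0 0) * (f 0 0 ^+ 2 + f 1 0 ^+ 2) = f 0 0 * g - f 1 0 * k.
  by rewrite /g /k; ring.
have e2 : (x 0 1 - y 0 1) * (f 0 0 ^+ 2 + f 1 0 ^+ 2) = f 1 0 * g + f 0 0 * k.
  by rewrite /g /k; ring.
rewrite /g /k h1 h2 !mulr0 ?subr0 ?addr0 in e1 e2.
apply: row2P; apply/eqP; rewrite -subr_eq0.
  by move/eqP: e1; rewrite mulf_eq0 (negbTE n0) orbF.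
by move/eqP: e2; rewrite mulf_eq0 (negbTE n0) orbF.
Qed.

Lemma vertex_in (P : set 'rV[R]_2) v : vertex P v -> P v.
Proof.
move=> [a [b [_ vE]]]; have : [set v] v by [].
by rewrite vE => -[].
Qed.

(* Perturbing f by a small multiple of the orthogonal functional makes the
   maximizer unique. *)
Lemma vertex_max_neq0 (P : set 'rV[R]_2) f : polytope P -> P !=set0 -> f != 0 ->
  exists2 v, vertex P v & forall x, P x -> dot x f <= dot v f.
Proof.
move=> [A /finite_seqP[s ->] PE] [x0 Px0] f0.
have [x xs] : exists x, x \in s.
  apply: contrapT => h.
  suff : conv_hull [set` s] `<=` set0 by move=> /(_ x0); rewrite -PE => /(_ Px0).
  apply: conv_hull_min => [|y ys]; last by apply: h; exists y.
  by apply/convex_setP.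
have [m ms mmax] := seq_argmax (fun x => dot x f) xs.
(* Ties among the maximizers of f are broken by [rot f]. *)
have [v] := @seq_argmax _ [seq y <- s | dot y f == dot m f] (fun x => dot x (rot f)) m
  ltac:(by rewrite mem_filter eqxx).
rewrite mem_filter => /andP[/eqP vm vs] vmax.
have [y ys|e e0 es] := @small_multiplier R _ s (fun y => dot v f - dot y f)
    (fun y => dot y (rot f) - dot v (rot f)).
  have := mmax y ys; rewrite -vm le_eqVlt => /orP[/eqP yv|yv]; last by left; rewrite subr_gt0.
  right; rewrite yv subrr; split=> //; rewrite subr_le0 vmax// mem_filter ys andbT.
  by rewrite yv vm.
(* Multiplier e gives weak inequalities; half of it makes them strict. *)
pose h := f + (e / 2) *: rot f.
have hE z : dot z h = dot z f + e / 2 * dot z (rot f) by rewrite dotDr dotZr.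
have sh y : y \in s -> y != v -> dot y h < dot v h.
  move=> ys yv; rewrite !hE; have := es y ys; have := mmax y ys; rewrite -vm.
  rewrite le_eqVlt => /orP[/eqP yvf _|? ?]; last by nra.
  have : dot y (rot f) <= dot v (rot f).
    by apply: vmax; rewrite mem_filter ys yvf vm eqxx.
  rewrite le_eqVlt => /orP[/eqP yvr|?]; last by nra.
  by move/eqP: yv; case; apply: dot_rot_inj yvf yvr.
(* An open half-plane together with one point of its boundary is convex, so it contains P once it
   contains the generators. *)
have Ph : P `<=` [set z | z = v \/ dot z h < dot v h].
  rewrite PE; apply: conv_hull_min => [|y ys /=]; last first.
    by have [->|yv] := eqVneq y v; [left|right; apply: sh].
  apply/convex_setP => y z t /andP[t0 t1] /= yv zv.
  have yle : dot y h <= dot v h by case: yv => [->//|/ltW].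
  have zle : dot z h <= dot v h by case: zv => [->//|/ltW].
  have [tE|tn0] := eqVneq t 0; first by rewrite tE scale0r add0r subr0 scale1r.
  have [tE|tn1] := eqVneq t 1; first by rewrite tE scale1r subrr scale0r addr0.
  have {}t0 : 0 < t by rewrite lt_neqAle eq_sym tn0.
  have {}t1 : t < 1 by rewrite lt_neqAle tn1.
  case: yv => [->|yv]; last by right; rewrite dotD !dotZ; nra.
  case: zv => [->|zv]; last by right; rewrite dotD !dotZ; nra.
  by left; rewrite -scalerDl addrC subrK scale1r.
exists v.
  exists h, (dot v h); split=> [z /Ph[->|/ltW]//|].
  apply/seteqP; split=> [_ ->|z [/Ph[//|]]]; last first.
    by rewrite -/(dot _ _) => /[swap] ->; rewrite ltxx.
  by split=> //; rewrite PE; apply: sub_conv_hull.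
rewrite PE; apply: conv_hull_min; first exact: convex_halfspace.
by move=> y ys; rewrite /= vm; apply: mmax.
Qed.

Lemma vertex_max (P : set 'rV[R]_2) f : polytope P -> P !=set0 ->
  exists2 v, vertex P v & forall x, P x -> dot x f <= dot v f.
Proof.
move=> polP P0; have [->|] := eqVneq f 0; last exact: vertex_max_neq0.
have [|v Pv _] := @vertex_max_neq0 P (const_mx 1) polP P0.
  by apply/eqP => /matrixP/(_ 0 0); rewrite !mxE => /eqP; rewrite oner_eq0.
by exists v => // x _; rewrite /dot !mulmx0.
Qed.

Lemma affdim_le d (S : set 'rV[R]_d) : affdim S <= d%:Z.
Proof.
have [k [X [Xfree _ ->]]] := affdim_witness S.
have := rank_leq_col (row_mx X (const_mx 1 : 'cV_k)).
by rewrite (eqP Xfree) lerBlDr -PoszD lez_nat.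
Qed.

(** A polygon has the affine dimension of the plane, so an equation valid on it would hold
    everywhere, in particular at 0 and at [f^T]. *)
Lemma polygon_not_in_line (P : set 'rV[R]_2) f b : polygon P -> f != 0 ->
  ~ (forall x, P x -> dot x f = b).
Proof.
move=> [_ dP] f0 Pfb.
have dT : affdim P = affdim [set: 'rV[R]_2].
  by apply/eqP; rewrite eq_le affdim_mono//= dP affdim_le.
have all_b x : dot x f = b by apply: (affdim_eq_hyperplane _ dT).
have b0 : b = 0 by rewrite -(all_b 0) /dot mul0mx mxE.
by move/eqP: (sqnorm_neq0 f0) (all_b f^T); rewrite dot2 !mxE b0 !expr2.
Qed.

End Plane.

(** * Stereographic projection and chords of the circle *)

Section Stereographic.
Variables (R : realType) (c : 'rV[R]_2) (n1 n2 : R).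
Hypothesis n_neq0 : n1 ^+ 2 + n2 ^+ 2 != 0.
Implicit Types (x y : 'rV[R]_2) (a b t : R).

(* Coordinates in which the circle is the unit circle and the centre of the
   projection is (1, 0). *)
Definition xcoord x :=
  ((x 0 0 - c 0 0) * n1 + (x 0 1 - c 0 1) * n2) / (n1 ^+ 2 + n2 ^+ 2).
Definition ycoord x :=
  ((x 0 1 - c 0 1) * n1 - (x 0 0 - c 0 0) * n2) / (n1 ^+ 2 + n2 ^+ 2).

Definition stereo x := ycoord x / (1 - xcoord x).

(** The affine form vanishing on the line through the circle points with parameters a and b. On the
    circle [t^2 = (1 + X) / (1 - X)], and this is [(1 - X) (t - a) (t - b)] expanded. *)
Definition chord a b x :=
  (1 + xcoord x) - (a + b) * ycoord x + a * b * (1 - xcoord x).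

Lemma coordsK x :
  x 0 0 = c 0 0 + n1 * xcoord x - n2 * ycoord x /\
  x 0 1 = c 0 1 + n2 * xcoord x + n1 * ycoord x.
Proof. by rewrite /xcoord /ycoord; split; field. Qed.

Definition chord_lin a b : 'cV[R]_2 := \col_i
  ((if i == 0 then (1 - a * b) * n1 + (a + b) * n2
    else (1 - a * b) * n2 - (a + b) * n1) / (n1 ^+ 2 + n2 ^+ 2)).

Lemma chord_affine a b x : chord a b x = dot x (chord_lin a b) + chord a b 0.
Proof. by rewrite dot2 /chord /xcoord /ycoord !mxE /=; field. Qed.

Definition on_circle x := xcoord x ^+ 2 + ycoord x ^+ 2 = 1 /\ xcoord x < 1.

Lemma on_circleP x : on_circle x ->
  [/\ xcoord x = (stereo x ^+ 2 - 1) / (stereo x ^+ 2 + 1),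
      ycoord x = 2 * stereo x / (stereo x ^+ 2 + 1) &
      1 - xcoord x = 2 / (stereo x ^+ 2 + 1)].
Proof.
rewrite /on_circle /stereo; move: (xcoord x) (ycoord x) => X Y [XY X1].
have X0 : 1 - X != 0 by rewrite subr_eq0 gt_eqF.
have Y2 : Y ^+ 2 = 1 - X ^+ 2 by rewrite -XY addrAC subrr add0r.
have -> : (Y / (1 - X)) ^+ 2 + 1 = 2 / (1 - X) by rewrite exprMn Y2; field.
have -> : (Y / (1 - X)) ^+ 2 - 1 = 2 * X / (1 - X) by rewrite exprMn Y2; field.
by split; field.
Qed.

Lemma stereo_inj x y : on_circle x -> on_circle y -> stereo x = stereo y -> x = y.
Proof.
move=> /on_circleP[xX xY _] /on_circleP[yX yY _] xy.
have [x0 x1] := coordsK x; have [y0 y1] := coordsK y.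
by apply: row2P; rewrite ?x0 ?x1 ?y0 ?y1 xX xY yX yY xy.
Qed.

Lemma chord_on_circle a b x : on_circle x ->
  chord a b x = (1 - xcoord x) * ((stereo x - a) * (stereo x - b)).
Proof.
move=> /on_circleP[xX xY x1]; rewrite /chord x1 xX xY.
have : stereo x ^+ 2 + 1 != 0 by rewrite gt_eqF// ltr_wpDl ?sqr_ge0.
by move: (stereo x) => t t0; field.
Qed.

(** The barycentric coordinate of x at a corner is the chord of the opposite side, divided by its
    value at that corner. *)
Lemma triangle p q w x : on_circle p -> on_circle q -> on_circle w ->
  stereo p < stereo q -> stereo q < stereo w ->
  0 <= chord (stereo q) (stereo w) x -> chord (stereo p) (stereo w) x <= 0 ->
  0 <= chord (stereo p) (stereo q) x ->
  exists u v z, [/\ 0 <= u, 0 <= v, 0 <= z, u + v + z = 1 &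
    x = u *: p + v *: q + z *: w].
Proof.
move=> /on_circleP[pX pY _] /on_circleP[qX qY _] /on_circleP[wX wY _].
have [x0 x1] := coordsK x; have [p0 p1] := coordsK p.
have [q0 q1] := coordsK q; have [w0 w1] := coordsK w.
rewrite pX pY in p0 p1; rewrite qX qY in q0 q1; rewrite wX wY in w0 w1.
move: (stereo p) (stereo q) (stereo w) p0 p1 q0 q1 w0 w1 {pX pY qX qY wX wY}.
move=> a b d p0 p1 q0 q1 w0 w1 ab bd hbd had hab.
have ab0 : b - a != 0 by rewrite subr_eq0 gt_eqF.
have bd0 : d - b != 0 by rewrite subr_eq0 gt_eqF.
have ad0 : d - a != 0 by rewrite subr_eq0 gt_eqF// (lt_trans ab).
have s0 t : t ^+ 2 + 1 != 0 by rewrite gt_eqF// ltr_wpDl ?sqr_ge0.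
have sa := s0 a; have sb := s0 b; have sd := s0 d.
have s_ge0 t : 0 <= (t ^+ 2 + 1) / 2 by rewrite divr_ge0 ?addr_ge0 ?sqr_ge0.
(* Lagrange interpolation at the nodes a, b, d *)
exists ((a ^+ 2 + 1) / 2 * (chord b d x / ((b - a) * (d - a)))),
       ((b ^+ 2 + 1) / 2 * (- chord a d x / ((b - a) * (d - b)))),
       ((d ^+ 2 + 1) / 2 * (chord a b x / ((d - a) * (d - b)))).
have dab : 0 <= b - a by rewrite subr_ge0 ltW.
have dbd : 0 <= d - b by rewrite subr_ge0 ltW.
have dad : 0 <= d - a by rewrite subr_ge0 ltW// (lt_trans ab).
split; try by rewrite mulr_ge0// divr_ge0// ?mulr_ge0// oppr_ge0.
  by rewrite /chord; move: (xcoord x) (ycoord x) => X Y; field; rewrite ab0 bd0 ad0.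
rewrite /chord; move: (xcoord x) (ycoord x) x0 x1 => X Y x0 x1.
by apply: row2P; rewrite !mxE ?x0 ?x1 ?p0 ?q0 ?w0 ?p1 ?q1 ?w1; field;
  rewrite ab0 bd0 ad0 sa sb sd.
Qed.

End Stereographic.

(** * Choice of the projection centre and vertices of a polygon *)

Section Inscribed.
Variable R : realType.
Implicit Types (P : set 'rV[R]_2) (x v : 'rV[R]_2).

(** The circle points with rational parameters j = 0, 1, 2, ... have distinct first coordinates, so
    a finite list misses one of them. *)
Lemma free_direction (s : seq 'rV[R]_2) (c : 'rV[R]_2) (r : R) : 0 < r ->
  exists n1 n2, n1 ^+ 2 + n2 ^+ 2 = r ^+ 2 /\
    forall v, v \in s -> ~ (v 0 0 = c 0 0 + n1 /\ v 0 1 = c 0 1 + n2).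
Proof.
move=> r0.
pose f (j : nat) : R := c 0 0 + r * (1 - j%:R ^+ 2) / (1 + j%:R ^+ 2).
have s0 (j : nat) : 1 + j%:R ^+ 2 != 0 :> R by rewrite gt_eqF// ltr_pwDl ?sqr_ge0.
have f_inj : injective f.
  move=> i j /addrI /eqP; rewrite eqr_div// -!mulrA => /eqP/(mulfI (lt0r_neq0 r0)) ij.
  have /eqP : i%:R ^+ 2 = j%:R ^+ 2 :> R by nra.
  by rewrite eqrXn2// eqr_nat => /eqP.
have [j js] : exists j, f j \notin [seq v 0 0 | v : 'rV_2 <- s].
  apply: contrapT => h.
  have f_uniq : uniq (map f (iota 0 (size s).+1)) by rewrite map_inj_uniq// iota_uniq.
  have f_sub : {subset map f (iota 0 (size s).+1) <= [seq v 0 0 | v : 'rV_2 <- s]}.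
    by move=> _ /mapP[j _ ->]; apply/negPn/negP => js; apply: h; exists j.
  by have := uniq_leq_size f_uniq f_sub; rewrite !size_map size_iota ltnn.
exists (r * (1 - j%:R ^+ 2) / (1 + j%:R ^+ 2)), (r * (2 * j%:R) / (1 + j%:R ^+ 2)).
split; first by field.
move=> v vs [vj _]; move/negP: js; apply.
by apply/mapP; exists v; rewrite ?vj// /f.
Qed.

Lemma circle_on_circle (c : 'rV[R]_2) (n1 n2 r : R) x :
  n1 ^+ 2 + n2 ^+ 2 = r ^+ 2 -> 0 < r -> circle c r x ->
  ~ (x 0 0 = c 0 0 + n1 /\ x 0 1 = c 0 1 + n2) -> on_circle c n1 n2 x.
Proof.
move=> nr r0; rewrite /circle /= => xr xn.
have n0 : n1 ^+ 2 + n2 ^+ 2 != 0 by rewrite nr expf_neq0// gt_eqF.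
have XY : xcoord c n1 n2 x ^+ 2 + ycoord c n1 n2 x ^+ 2 = 1.
  transitivity (((x 0 0 - c 0 0) ^+ 2 + (x 0 1 - c 0 1) ^+ 2) / (n1 ^+ 2 + n2 ^+ 2)).
    by rewrite /xcoord /ycoord; field.
  by rewrite xr nr divff// expf_neq0// gt_eqF.
split=> //; rewrite lt_neqAle; apply/andP; split; last by nra.
apply/eqP => X1; apply: xn; have [x0 x1] := coordsK c n0 x.
have Y0 : ycoord c n1 n2 x = 0.
  by apply/eqP; rewrite -sqrf_eq0; apply/eqP; move: XY; rewrite X1; lra.
by rewrite x0 x1 X1 Y0 !mulr0 !mulr1 subr0 addr0.
Qed.

Lemma exists_orthogonal x : exists2 f : 'cV[R]_2, f != 0 & dot x f = 0.
Proof.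
have [->|x0] := eqVneq x 0.
  exists (const_mx 1); last by rewrite /dot mul0mx mxE.
  by apply/eqP => /matrixP/(_ 0 0); rewrite !mxE => /eqP; rewrite oner_eq0.
exists (rot x^T); last by rewrite dot2 !mxE /=; ring.
apply: contraNneq x0 => /colP h; apply/eqP/row2P.
  by have := h 1; rewrite !mxE.
by have := h 0; rewrite !mxE /= => /eqP; rewrite oppr_eq0 => /eqP.
Qed.

Lemma polygon_neq0 P : polygon P -> P !=set0.
Proof.
by move=> [_ dP]; apply/set0P/eqP => P0; move: dP; rewrite P0 affdim_set0.
Qed.

(** A functional with equal values at p and q would attain its maximum and minimum over P at p or q,
    hence be constant on P. *)
Lemma polygon_vertices P p q : polygon P -> ~ (forall v, vertex P v -> v = p \/ v = q).
Proof.
move=> polP Vpq; have [f f0 fpq] := exists_orthogonal (p - q).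
have {}fpq : dot p f = dot q f by apply/eqP; rewrite -subr_eq0 -dotN -dotD fpq.
apply: (polygon_not_in_line (b := dot p f) polP f0) => x Px.
have [v /Vpq vpq vmax] := vertex_max f (proj1 polP) (polygon_neq0 polP).
have [w /Vpq wpq wmax] := vertex_max (- f) (proj1 polP) (polygon_neq0 polP).
have Nf y : dot y (- f) = - dot y f by rewrite -scaleN1r dotZr mulN1r.
have := vmax x Px; have := wmax x Px; rewrite !Nf lerN2.
have -> : dot v f = dot p f by case: vpq => ->.
have -> : dot w f = dot p f by case: wpq => ->.
by move=> h1 h2; apply/eqP; rewrite eq_le h1 h2.
Qed.

Lemma convex_set3 (d : nat) (C : set 'rV[R]_d) (x y z : 'rV[R]_d) a b e :
  convex_set C -> C x -> C y -> C z -> 0 <= a -> 0 <= b -> 0 <= e ->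
  a + b + e = 1 -> C (a *: x + b *: y + e *: z).
Proof.
move=> /convex_setP cC Cx Cy Cz a0 b0 e0 abe.
have [ab0|ab0] := eqVneq (a + b) 0.
  have [-> ->] : a = 0 /\ b = 0.
    by move/eqP: ab0; rewrite paddr_eq0// => /andP[/eqP-> /eqP->].
  by rewrite ab0 add0r in abe; rewrite !scale0r !add0r abe scale1r.
have ab : 0 < a + b by rewrite lt_neqAle eq_sym ab0 addr_ge0.
have -> : a *: x + b *: y + e *: z =
    (a + b) *: ((a / (a + b)) *: x + (1 - a / (a + b)) *: y) + (1 - (a + b)) *: z.
  rewrite (_ : e = 1 - (a + b)); last by rewrite -abe; ring.
  by apply/rowP => i; rewrite !mxE; field.
apply: (cC) => //; first by rewrite ltW//=; lra.
apply: cC => //; rewrite divr_ge0 ?(ltW ab)//=.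
by rewrite ler_pdivrMr// mul1r lerDl.
Qed.

(** * Edge inequalities of the inscribed polygon *)

Section SlackSystem.
Variables (P : set 'rV[R]_2) (n : nat) (p : nat -> 'rV[R]_2).
Variables (c : 'rV[R]_2) (n1 n2 : R).
Hypothesis n_neq0 : n1 ^+ 2 + n2 ^+ 2 != 0.
Hypotheses (polP : polytope P) (P0 : P !=set0) (n_gt2 : (2 < n)%N).
Hypothesis pV : forall k, (k < n)%N -> vertex P (p k).
Hypothesis pVS : forall v, vertex P v -> exists2 k, (k < n)%N & v = p k.
Hypothesis p_circle : forall k, (k < n)%N -> on_circle c n1 n2 (p k).

Local Notation t k := (stereo c n1 n2 (p k)).
Local Notation chord := (chord c n1 n2).
Local Notation chord_lin := (chord_lin n1 n2).
Hypothesis p_sorted : forall i j, (i < j)%N -> (j < n)%N -> t i < t j.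

(** [Some j] is the edge between consecutive vertices, [None] the closing edge; its sign is reversed
    because all parameters lie between its two ends. *)
Definition slack (j : option 'I_n.-1) x :=
  if j is Some j then chord (t j) (t j.+1) x else - chord (t 0) (t n.-1) x.

Definition slack_lin (j : option 'I_n.-1) : 'cV[R]_2 :=
  if j is Some j then chord_lin (t j) (t j.+1) else - chord_lin (t 0) (t n.-1).

Lemma slack_affine j x : slack j x = dot x (slack_lin j) + slack j 0.
Proof.
case: j => [j|] /=; first exact: chord_affine.
by rewrite -scaleN1r dotZr mulN1r -opprD -chord_affine.
Qed.

Let t_le i j : (i <= j)%N -> (j < n)%N -> t i <= t j.
Proof. by rewrite leq_eqVlt => /orP[/eqP->//|ij jn]; apply/ltW/p_sorted. Qed.

Lemma slack_vertex_ge0 j i : (i < n)%N -> 0 <= slack j (p i).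
Proof.
move=> i_n; have [_ x1] := p_circle i_n.
have n0 : (n.-1 < n)%N by rewrite prednK// (leq_trans _ n_gt2).
case: j => [j|] /=; rewrite (chord_on_circle _ _ (p_circle i_n)); last first.
  rewrite -mulrN mulr_ge0 ?subr_ge0 ?(ltW x1)// oppr_ge0 mulr_ge0_le0 ?subr_ge0 ?subr_le0//.
    exact: t_le.
  by apply: t_le => //; rewrite -ltnS prednK// (leq_trans _ n_gt2).
rewrite mulr_ge0 ?subr_ge0 ?(ltW x1)//.
have jn : (j.+1 < n)%N by rewrite -ltn_predRL.
have [ij|ji] := leqP i j.
  by rewrite mulr_le0// subr_le0 t_le// ?(ltnW jn)// (leq_trans ij).
by rewrite mulr_ge0// subr_ge0 t_le// ltnW.
Qed.

(** Fan triangulation from [p 0]: for the least k > 1 with x on the nonpositive side of the chord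
    from [p 0] to [p k], x lies in the triangle of [p 0], [p k.-1] and [p k]. The closing edge shows
    that such a k exists. *)
Lemma slack_conv_hull x : (forall j, 0 <= slack j x) ->
  conv_hull (range (fun i : 'I_n => p i)) x.
Proof.
move=> xs; have n0 : (0 < n)%N by apply: leq_trans n_gt2.
have ex : exists k, [&& (1 < k)%N, (k < n)%N & chord (t 0) (t k) x <= 0].
  exists n.-1; rewrite -ltnS prednK// n_gt2 leqnn /=.
  by have := xs None; rewrite /= oppr_ge0.
case: (ex_minnP ex) => -[|[|m]] // /and3P[_ m_n m_neg] m_min {ex}.
have m_pos : 0 <= chord (t 0) (t m.+1) x.
  have h : (0 < n.-1)%N by rewrite -ltnS prednK// (ltn_trans _ n_gt2).
  case: m m_n m_neg m_min => [|m] m_n m_neg m_min; first exact: xs (Some (Ordinal h)).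
  rewrite leNgt; apply/negP => /ltW neg.
  by have := m_min m.+2; rewrite neg (ltnW m_n)/= ltnn => /(_ isT).
have m_edge : (m.+1 < n.-1)%N by rewrite -ltnS prednK.
have [u [v [z [u0 v0 z0 uvz ->]]]] := triangle n_neq0 (p_circle n0)
  (p_circle (ltnW m_n)) (p_circle m_n) (p_sorted (ltn0Sn m) (ltnW m_n))
  (p_sorted (ltnSn m.+1) m_n) (xs (Some (Ordinal m_edge))) m_neg m_pos.
have pC k (kn : (k < n)%N) : conv_hull (range (fun i : 'I_n => p i)) (p k).
  by apply: sub_conv_hull; exists (Ordinal kn).
apply: (convex_set3 (@conv_hull_convex _ _ _)) => //; apply: pC => //.
exact: ltnW.
Qed.

(** An affine function attains its minimum over P at a vertex. *)
Lemma slack_valid x j : P x -> 0 <= slack j x.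
Proof.
move=> Px; have [v /pVS[i i_n ->] vmax] := vertex_max (- slack_lin j) polP P0.
have Nf y : dot y (- slack_lin j) = - dot y (slack_lin j).
  by rewrite -scaleN1r dotZr mulN1r.
have := vmax x Px; rewrite !Nf lerN2 => vx.
by apply: le_trans (slack_vertex_ge0 j i_n) _; rewrite slack_affine (slack_affine j x) lerD2r.
Qed.

Lemma conv_hull_vertices : conv_hull (range (fun i : 'I_n => p i)) `<=` P.
Proof.
have [A _ PE] := polP; apply: conv_hull_min; first by rewrite PE; apply: conv_hull_convex.
by move=> _ [i _ <-]; apply: vertex_in; apply: pV.
Qed.

Lemma polygon_slack : P = [set x | forall j, 0 <= dot x (slack_lin j) + slack j 0].
Proof.
apply/seteqP; split=> x /= h => [j|]; first by rewrite -slack_affine slack_valid.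
apply: conv_hull_vertices; apply: slack_conv_hull => j.
by rewrite slack_affine; apply: h.
Qed.

Lemma polygon_conv_hull : P = conv_hull (range (fun i : 'I_n => p i)).
Proof.
apply/seteqP; split; last exact: conv_hull_vertices.
by move=> x Px; apply: slack_conv_hull => j; apply: slack_valid.
Qed.

End SlackSystem.

End Inscribed.

(* Allows for numbers of vertices that are not perfect squares. *)
Lemma increasing_extension (R : realFieldType) (t : nat -> R) n :
  (forall i j, (i < j)%N -> (j < n)%N -> t i < t j) ->
  exists2 tau : nat -> R, {homo tau : i j / (i < j)%N >-> i < j} &
    forall i, (i < n)%N -> tau i = t i.
Proof.
move=> t_lt; exists (fun i => if (i < n)%N then t i else t n.-1 + i%:R) => [i j ij|i -> //].
case: (ltnP j n) => jn; first by rewrite (ltn_trans ij jn) t_lt.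
have j0 : 0 < j%:R :> R by rewrite ltr0n; apply: leq_trans ij.
case: (ltnP i n) => i_n; last by rewrite ltrD2l ltr_nat.
rewrite ltr_pwDr//; have [->//|ni] := eqVneq i n.-1.
rewrite ltW// t_lt//; last by case: (n) i_n.
by rewrite ltn_neqAle ni -ltnS prednK//; case: (n) i_n.
Qed.

Lemma sorted_vertices (R : realType) (P : set 'rV[R]_2) n (t : 'rV[R]_2 -> R) :
  vertex P #= `I_n ->
  (forall v w, vertex P v -> vertex P w -> t v = t w -> v = w) ->
  exists p : nat -> 'rV[R]_2,
    [/\ forall k, (k < n)%N -> vertex P (p k),
        forall v, vertex P v -> exists2 k, (k < n)%N & v = p k &
        forall i j, (i < j)%N -> (j < n)%N -> t (p i) < t (p j)].
Proof.
move=> nP t_inj; pose sv := finmap.enum_fset (fset_set (vertex P)).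
have Vfin : finite_set (vertex P) by apply/finite_setP; exists n.
have svE v : v \in sv = (v \in (vertex P : set _)) by rewrite in_fset_set.
pose s := sort (fun v w => t v <= t w) sv.
have sE v : (v \in s) = (v \in (vertex P : set _)) by rewrite mem_sort svE.
have s_size : size s = n by rewrite size_sort (card_fset_set nP).
have s_uniq : uniq s by rewrite sort_uniq finmap.fset_uniq.
have sV k : (k < n)%N -> vertex P (nth 0 s k).
  by move=> kn; apply: set_mem; rewrite -sE mem_nth// s_size.
exists (nth 0 s); split=> // [v /mem_set|i j ij jn].
  by rewrite -sE => vs; exists (index v s); rewrite ?nth_index// -s_size index_mem.
rewrite lt_neqAle; apply/andP; split.
  apply/eqP => /(t_inj _ _ (sV _ (ltn_trans ij jn)) (sV _ jn))/eqP.
  by rewrite nth_uniq ?s_size ?(ltn_trans ij jn)// => /eqP ij'; rewrite ij' ltnn in ij.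
have le_tr : transitive (fun v w => t v <= t w) by move=> u v w; apply: le_trans.
have le_rf : reflexive (fun v w => t v <= t w) by move=> v; apply: lexx.
have s_sorted : sorted (fun v w => t v <= t w) s.
  by apply: sort_sorted => v w; apply: le_total.
apply: (sorted_leq_nth le_tr le_rf 0 s_sorted); rewrite ?inE ?s_size//.
- exact: ltn_trans jn.
- exact: ltnW.
Qed.

Theorem theorem1p3 (R : realType) (n : nat) (P : set 'rV[R]_2)
    (cycP : cyclic_polygon P) (nP : vertex P #= `I_n) :
  (xc P <= (24 * Num.sqrt (n%:R : R))%:E)%E.
Proof.
have [polP [c [r [r0 Vc]]]] := cycP.
have P0 := polygon_neq0 polP.
have /finite_seqP[s sE] : finite_set (vertex P) by apply/finite_setP; exists n.
have [n1 [n2 [n_r n_s]]] := free_direction s c r0.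
have n_neq0 : n1 ^+ 2 + n2 ^+ 2 != 0 by rewrite n_r expf_neq0// gt_eqF.
have V_circle v : vertex P v -> on_circle c n1 n2 v.
  move=> Vv; apply: circle_on_circle n_r r0 (Vc v Vv) _; apply: n_s.
  by rewrite sE in Vv.
have [v w Vv Vw|p [pV pVS p_sorted]] := sorted_vertices (t := stereo c n1 n2) nP.
  by apply: stereo_inj => //; apply: V_circle.
have n_gt2 : (2 < n)%N.
  rewrite ltnNge; apply/negP => n2'; apply: (@polygon_vertices _ P (p 0) (p 1) polP).
  by move=> v /pVS[k kn ->]; case: k kn => [|[|k]] kn; [left|right|have := leq_trans kn n2'].
have p_circle k : (k < n)%N -> on_circle c n1 n2 (p k) by move=> /pV/V_circle.
(* The factorization needs a full square number of parameters, which may exceed n. *)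
have [tau tau_lt tauE] := increasing_extension p_sorted.
(* With [s = s'.+1], both [n <= s^2] and [s <= sqrt n + 1] hold. *)
pose s' := Num.truncn (Num.sqrt (n%:R : R)).
have /andP[s'_le s'_gt] : s'%:R <= Num.sqrt (n%:R : R) < s'.+1%:R.
  by apply: truncn_itv; rewrite sqrtr_ge0.
have n_s2 : (n <= s'.+1 * s'.+1)%N.
  rewrite -(ler_nat R) natrM -[leLHS]sqr_sqrtr// expr2.
  by rewrite ler_pM ?sqrtr_ge0// ltW.
have [U [V [U0 V0 UV]]] := edge_factorization s' tau_lt.
pose K := (('I_7 * 'I_s'.+1 + 'I_s'.+1 * 'I_3) + unit)%type.
(* Rows are rescaled by the positive factor relating [chord] to the product of parameter
   differences; the extra coordinate carries the closing edge alone. *)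
pose U' (i : 'I_n) (k : K) := match k with
  | inl k => (1 - xcoord c n1 n2 (p i)) * U i k
  | inr _ => @slack R n p c n1 n2 None (p i)
  end.
pose V' (k : K) (j : option 'I_n.-1) := match k, j with
  | inl k, Some j => V k j
  | inl _, None => 0
  | inr _, Some _ => 0
  | inr _, None => 1
  end.
have small i : (i < n)%N -> (i < s'.+1 * s'.+1)%N by move=> i_n; apply: leq_trans n_s2.
have edge_small (j : 'I_n.-1) : (j.+1 < n)%N by rewrite -ltn_predRL.
have cardK : #|{: K}| = (10 * s'.+1 + 1)%N.
  by rewrite !card_sum !card_prod !card_ord card_unit; lia.
apply: (@le_trans _ _ (#|{: K}|%:R)%:E).
  apply: (@xc_le_factorization _ _ P 'I_n (option 'I_n.-1) None _ (fun i => p i)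
    (@slack_lin R n p c n1 n2) (fun j => @slack R n p c n1 n2 j 0)
    (fun i k => U' i (enum_val k)) (fun k j => V' (enum_val k) j) (p 0) (p 1)).
  - exact: (polygon_conv_hull n_neq0 (proj1 polP) P0 n_gt2 pV pVS p_circle p_sorted).
  - exact: (polygon_slack n_neq0 (proj1 polP) P0 n_gt2 pV pVS p_circle p_sorted).
  - move=> i k; case: (enum_val k) => [k'|_] /=.
      by rewrite mulr_ge0 ?U0 ?small// subr_ge0 ltW//; have [] := p_circle _ (ltn_ord i).
    by apply: (slack_vertex_ge0 n_gt2 p_circle p_sorted None).
  - move=> k j; case: (enum_val k) => [k'|_] /=; case: j => [j|] //=.
      by rewrite V0// small// ltnW.
  - move=> i j; rewrite -slack_affine//.
    rewrite -(big_enum_val (A := {: K}) (fun k => U' i k * V' k j)) /=.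
    rewrite big_sumType /= (big_pred1 tt) => [|[]//].
    case: j => [j|] /=; last by rewrite big1 ?add0r ?mulr1// => k _; rewrite mulr0.
    under eq_bigr do rewrite -mulrA.
    rewrite mulr0 addr0 -mulr_sumr UV ?small//; last exact: ltnW.
    rewrite !tauE ?(ltnW (edge_small j))//.
    by rewrite (chord_on_circle _ _ (p_circle _ (ltn_ord i))).
  - by apply: vertex_in; apply: pV; apply: leq_trans n_gt2.
  - by apply: vertex_in; apply: pV; apply: ltn_trans n_gt2.
  - have n_gt1 : (1 < n)%N by apply: ltn_trans n_gt2.
    by move=> p01; have := p_sorted 0 1 isT n_gt1; rewrite p01 ltxx.
rewrite lee_fin cardK natrD natrM -natr1.
(* With [q = sqrt n] the count is at most [10 (q + 1) + 1], and [q >= 1] absorbs the constant 11. *)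
have : 1 <= Num.sqrt (n%:R : R).
  by rewrite -[leLHS]sqrtr1 ler_wsqrtr// ler1n (leq_trans _ n_gt2).
move: (Num.sqrt _) s'_le => q; lra.
Qed.
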